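(* There exist absolute constants $C_1, C_2$ such that for every linear interval graph $G$ with maximum degree $\Delta\geq 2$, $\mathrm{lcc}(G)\leq \log\Delta+\frac{1}{2}\log\log\Delta+C_1$, and if moreover $G$ is twin-free, then also $\mathrm{lcc}(G)\geq \frac{1}{2}\log\Delta+\frac{1}{4}\log\log\Delta-C_2$.
   Context: A linear interval graph is a graph whose vertices are finitely many points of the real line, together with a finite family of closed bounded intervals of the line, two vertices being adjacent iff both lie in some common interval of the family. A clique covering of a graph $G$ is a family $\mathcal{C}$ of cliques of $G$ such that every edge of $G$ is contained in at least one clique of $\mathcal{C}$; it is a $k$-clique covering if every vertex belongs to at most $k$ cliques of $\mathcal{C}$. $\mathrm{lcc}(G)$ is the smallest $k$ such that $G$ admits a $k$-clique covering. Two adjacent vertices $x,y$ are twins if $N(x)\setminus\{y\}=N(y)\setminus\{x\}$; a graph is twin-free if it has no twins. Logarithms are base $2$. *)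

(* Defs.v *)
From HB Require Import structures.
From mathcomp Require Import all_boot all_order all_algebra.
From mathcomp Require Import reals exp.

Set Implicit Arguments.
Unset Strict Implicit.
Unset Printing Implicit Defensive.

Import Order.TTheory GRing.Theory Num.Theory.

Local Open Scope ring_scope.

Record sgraph := SGraph {
  vertex :> finType;
  adj : rel vertex;
  adj_sym : symmetric adj;
  adj_irr : irreflexive adj
}.

Section Graph.
Variable G : sgraph.

Definition neighbours (x : G) : {set G} := [set y | adj x y].

Definition max_degree : nat := \max_(x : G) #|neighbours x|.

Definition clique (K : {set G}) : bool :=
  [forall x in K, forall y in K, (x != y) ==> adj x y].

(* Listing a clique several times never helps, so that a family of cliques is
   taken to be a set of cliques. *)
Definition clique_covering (C : {set {set G}}) : bool :=
  [forall K in C, clique K] &&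
  [forall x : G, forall y : G,
     adj x y ==> [exists K in C, (x \in K) && (y \in K)]].

Definition k_clique_covering (k : nat) (C : {set {set G}}) : bool :=
  clique_covering C && [forall x : G, (#|[set K in C | x \in K]| <= k)%N].

Definition has_k_clique_covering (k : nat) : bool :=
  [exists C : {set {set G}}, k_clique_covering k C].

Lemma ex_k_clique_covering : exists k, has_k_clique_covering k.
Proof.
exists #|{set G}|; apply/existsP; exists [set K | clique K].
apply/andP; split; last by apply/forallP=> x; exact: max_card.
apply/andP; split; first by apply/forall_inP=> K; rewrite inE.
apply/forallP=> x; apply/forallP=> y; apply/implyP=> xy.
apply/existsP; exists [set x; y]; rewrite !inE !eqxx orbT !andbT.
apply/forall_inP=> u; rewrite !inE => /orP[] /eqP-> {u};
  apply/forall_inP=> v; rewrite !inE => /orP[] /eqP-> {v};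
  by apply/implyP; rewrite ?eqxx // adj_sym.
Qed.

Definition lcc : nat := ex_minn ex_k_clique_covering.

Definition twins (x y : G) : bool :=
  adj x y && (neighbours x :\ y == neighbours y :\ x).

Definition twin_free : Prop := forall x y : G, ~~ twins x y.

(* The graph is given up to isomorphism: p places its vertices at distinct
   points of the line, and each pair in I holds the endpoints of an interval. *)
Definition linear_interval_graph (R : realType) : Prop :=
  exists (p : G -> R) (I : seq (R * R)),
    [/\ injective p,
        forall i, i \in I -> i.1 <= i.2 &
        forall x y : G, x != y ->
          adj x y = has (fun i => (p x \in `[i.1, i.2]) &&
                                  (p y \in `[i.1, i.2])) I].

End Graph.

Definition log2 (R : realType) (x : R) : R := ln x / ln 2.

(* Main.v *)
Require Import Defs.
From HB Require Import structures.
From mathcomp Require Import all_boot all_order all_algebra.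
From mathcomp Require Import reals exp.
From mathcomp Require Import zify ring lra.

Set Implicit Arguments.
Unset Strict Implicit.
Unset Printing Implicit Defensive.

Import Order.TTheory GRing.Theory Num.Theory.

Local Open Scope ring_scope.

(* Upper bound: cut the line into consecutive blocks that are cliques, such that
   edges stay in a block or join consecutive blocks. The edges between two
   consecutive blocks form a half graph, and the nodes of a binary search tree
   with C(2h, h) leaves cover a half graph on C(2h, h) levels by bicliques, each
   vertex lying in at most h of them. A vertex faces two neighbouring blocks, so
   lcc <= 2h + 1 as soon as C(2h, h) >= Delta + 2.

   Lower bound: consecutive vertices of a clique K of a twin-free graph are
   separated by a vertex to their right or to their left. Half of them are
   separated on the same side, and the families of cliques containing a vertex
   and its separator then satisfy the hypotheses of the skew Bollobas theorem, so
   |K| <= 1 + 2 C(2k, k) with k = lcc. The right neighbours of a vertex form a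
   clique with it, and so do the left ones; hence Delta <= 4 C(2k, k). *)

(** * Covering a half graph by bicliques *)

(* The leaves of a binary search tree are numbered from left to right and a node
   is labelled by the first leaf of its right subtree; A n (B n) holds the nodes
   having leaf n in their right (left) subtree. *)
Lemma half_graph_labels (a b : nat) : exists A B : nat -> seq nat,
  [/\ forall n, (size (A n) <= a)%N,
      forall n, (size (B n) <= b)%N,
      forall n s, s \in A n ++ B n -> (0 < s < 'C(a + b, a))%N &
      forall i j, (i < 'C(a + b, a))%N -> (j < 'C(a + b, a))%N ->
        has (mem (A j)) (B i) = (i < j)%N].
Proof.
elim: a b => [|a IHa] b.
  exists (fun=> [::]), (fun=> [::]); rewrite bin0; split=> //= i j.
  by rewrite !ltnS !leqn0 => /eqP-> /eqP->.
elim: b => [|b [A1 [B1 [sA1 sB1 lab1 AB1]]]].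
  exists (fun=> [::]), (fun=> [::]); rewrite addn0 binn; split=> //= i j.
  by rewrite !ltnS !leqn0 => /eqP-> /eqP->.
have [A2 [B2 [sA2 sB2 lab2 AB2]]] := IHa b.+1.
set t1 := 'C(a.+1 + b, a.+1) in lab1 AB1.
set t2 := 'C(a + b.+1, a) in lab2 AB2.
have -> : 'C(a.+1 + b.+1, a.+1) = (t1 + t2)%N.
  by rewrite addnS binS /t1 /t2 addSnnS.
have t1_gt0 : (0 < t1)%N by rewrite bin_gt0 leq_addr.
have t2_gt0 : (0 < t2)%N by rewrite bin_gt0 leq_addr.
(* The root is labelled [t1]. A leaf of its left subtree spends one unit of [b] on the root and a
   leaf of its right subtree one unit of [a], so Pascal's rule counts the leaves. The labels of the
   right subtree are shifted beyond [t1], which keeps the three sorts of labels apart. *)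
exists (fun j => if (j < t1)%N then A1 j else t1 :: map (addn t1) (A2 (j - t1)%N)).
exists (fun i => if (i < t1)%N then t1 :: B1 i else map (addn t1) (B2 (i - t1)%N)).
split=> [n|n|n s|i j it jt].
- case: ifP => _ /=; first exact: sA1.
  by rewrite ltnS size_map.
- case: ifP => _ /=; last by rewrite size_map.
  by rewrite ltnS.
- have Lb s' : s' \in A1 n ++ B1 n -> (0 < s' < t1 + t2)%N.
    by move/lab1; lia.
  have Rb s' : s' \in A2 (n - t1)%N ++ B2 (n - t1)%N -> (0 < t1 + s' < t1 + t2)%N.
    by move/lab2; lia.
  case: ifP => _; rewrite mem_cat ?inE.
    case/or3P => [h|/eqP->|h]; [|by lia|]; apply: Lb; rewrite mem_cat h ?orbT //.
  case/orP=> [/orP[/eqP->|/mapP[s' h ->]]|/mapP[s' h ->]]; first by lia.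
    by apply: Rb; rewrite mem_cat h.
  by apply: Rb; rewrite mem_cat h orbT.
have lA1 s : s \in A1 j -> (s < t1)%N.
  by move=> h; have := lab1 j s; rewrite mem_cat h => /(_ isT); lia.
have lB1 s : s \in B1 i -> (s < t1)%N.
  by move=> h; have := lab1 i s; rewrite mem_cat h orbT => /(_ isT); lia.
have lA2 s : s \in A2 (j - t1)%N -> (0 < s)%N.
  by move=> h; have := lab2 (j - t1)%N s; rewrite mem_cat h => /(_ isT); lia.
have lB2 s : s \in B2 (i - t1)%N -> (0 < s)%N.
  by move=> h; have := lab2 (i - t1)%N s; rewrite mem_cat h orbT => /(_ isT); lia.
case: (ltnP i t1) => hi; case: (ltnP j t1) => hj.
- rewrite /= AB1 // [t1 \in _](_ : _ = false) //.
  by apply/negP => /lA1; lia.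
- by rewrite /= inE eqxx /=; lia.
- rewrite [RHS](_ : _ = false); last by lia.
  apply/negbTE/hasPn => _ /mapP[s _ ->]; apply/negP => /lA1; lia.
- have -> : (i < j = (i - t1 < j - t1))%N by lia.
  rewrite -AB2; [|by lia..].
  rewrite has_map; apply: eq_in_has => s hs /=.
  rewrite inE mem_map; last exact: addnI.
  by have := lB2 _ hs; case: eqP => //; lia.
Qed.

(** * Estimates of central binomial coefficients *)

Lemma mul_central_bin m :
  (m.+1 * 'C(m.+1.*2, m.+1) = 2 * m.*2.+1 * 'C(m.*2, m))%N.
Proof.
rewrite doubleS -mul_bin_diag /=.
have h : (m.*2.+1 * 'C(m.*2, m) = m.+1 * 'C(m.*2.+1, m))%N.
  by rewrite (mul_bin_down m.*2.+1 m); congr (_ * _)%N; lia.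
by rewrite -mulnA h; lia.
Qed.

(** The induction step amounts to 4n(n + 1) <= (2n + 1)^2. The factor of order m, here and in
    [central_bin_upper], is the source of the log log terms. *)
Lemma central_bin_lower m :
  (0 < m)%N -> (16 ^ m <= 4 * m * 'C(m.*2, m) ^ 2)%N.
Proof.
case: m => // m _; elim: m => // m IH; move: (mul_central_bin m.+1).
rewrite (expnS 16); move: IH; set n := m.+1.
move: ('C(_, _)) ('C(_, _)) (16 ^ n)%N => c' c q IH e.
have: (4 * n * c ^ 2 * (16 * n.+1) <= 4 * n.+1 * c' ^ 2 * n.+1)%N.
  have -> : (4 * n.+1 * c' ^ 2 * n.+1 = 4 * (n.+1 * c') ^ 2)%N by ring.
  rewrite e; nia.
have: (0 < n.+1)%N by []; nia.
Qed.

(** The induction step amounts to (2k + 1)(2k + 3) <= 4(k + 1)^2. *)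
Lemma central_bin_upper k : ('C(k.*2, k) ^ 2 * k.*2.+1 <= 16 ^ k)%N.
Proof.
elim: k => // k IH; move: (mul_central_bin k).
rewrite (expnS 16); move: IH.
move: ('C(_, _)) ('C(_, _)) (16 ^ k)%N => c' c q IH e.
have: (c' ^ 2 * k.+1.*2.+1 * k.+1 ^ 2 <= 16 * (c ^ 2 * k.*2.+1) * k.+1 ^ 2)%N.
  have -> : (c' ^ 2 * k.+1.*2.+1 * k.+1 ^ 2 = (k.+1 * c') ^ 2 * k.+1.*2.+1)%N by ring.
  rewrite e; nia.
rewrite leq_pmul2r // => h.
by rewrite (leq_trans h) // leq_pmul2l.
Qed.

Lemma expn2_central_bin m : (2 ^ m <= 'C(m.*2, m))%N.
Proof.
case: (posnP m) => [-> //|m_gt0].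
have h : (4 * m <= 4 ^ m)%N.
  case: m m_gt0 => // m _; elim: m => // m IH; rewrite expnS; lia.
rewrite -(@leq_exp2r _ _ 2) // -expnM mulnC expnM.
rewrite -(@leq_pmul2l (4 ^ m)) ?expn_gt0 // -expnMn.
apply: leq_trans (central_bin_lower m_gt0) _.
by rewrite leq_mul2r h orbT.
Qed.

(** * The skew Bollobas theorem, by the polynomial method *)

(* The matrix (prod_k (P j).[y i k]) is triangular and nonsingular, and it
   factors through the multisets of b exponents in {0, ..., a}, because each row
   is a form of degree b in the a + 1 coefficients of P j. *)
Lemma triangular_evaluations (F : fieldType) (a b t : nat)
    (P : 'I_t -> {poly F}) (y : 'I_t -> 'I_b -> F) :
  (forall j, size (P j) <= a.+1)%N ->
  (forall i, \prod_k (P i).[y i k] != 0) ->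
  (forall i j : 'I_t, (i < j)%N -> \prod_k (P j).[y i k] = 0) ->
  (t <= 'C(a + b, a))%N.
Proof.
move=> szP diag upper.
(* Sorted tuples stand for multisets. When the product over k is expanded, the coefficient
   contributed by [P j] to the term of a choice [f] of exponents depends only on the multiset
   [type f]. *)
pose S := [set u : b.-tuple 'I_a.+1 | sorted leq (map val u)].
pose type (f : {ffun 'I_b -> 'I_a.+1}) : b.-tuple 'I_a.+1 :=
  sort_tuple (relpre val leq) [tuple f k | k < b].
have typeS f : type f \in S.
  by rewrite inE sorted_map; apply: sort_sorted => c d; apply: leq_total.
pose N := \matrix_(i < t, s < #|S|)
  \sum_(f | type f == enum_val s) \prod_k y i k ^+ f k.
pose Q := \matrix_(s < #|S|, j < t) \prod_(c <- enum_val s) (P j)`_c.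
have entry i j : (N *m Q) i j = \prod_k (P j).[y i k].
  transitivity (\prod_k \sum_(c < a.+1) (P j)`_c * y i k ^+ c); last first.
    by apply: eq_bigr => k _; rewrite -horner_coef_wide.
  rewrite bigA_distr_bigA (partition_big type [in S]) //=.
  rewrite mxE [RHS]big_enum_val; apply: eq_bigr => s _.
  rewrite !mxE mulr_suml; apply: eq_bigr => f /eqP <-.
  rewrite big_split mulrC; congr (_ * _).
  rewrite (perm_big (map f (enum 'I_b))) ?big_map ?big_enum //.
  by rewrite perm_sort.
have trig : is_trig_mx (N *m Q).
  by apply/is_trig_mxP => i j ij; rewrite entry upper.
have unitNQ : N *m Q \in unitmx.
  rewrite unitmxE det_trig // unitfE; apply/prodf_neq0 => i _.
  by rewrite entry.
rewrite -(mxrank_unit unitNQ) (leq_trans (mxrankM_maxl _ _)) //.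
rewrite (leq_trans (rank_leq_col _)) // card_sorted_tuples addnC -bin_sub.
  by rewrite addnK.
exact: leq_addl.
Qed.

(** Elements become distinct positive rationals and [P j] gets the roots [A j]; its product over the
    points of [B i] then vanishes exactly when [A j] meets [B i]. *)
Lemma skew_bollobas (T : finType) (a b t : nat) (A B : 'I_t -> {set T}) :
  (forall j, #|A j| <= a)%N -> (forall i, #|B i| <= b)%N ->
  (forall i, [disjoint A i & B i]) ->
  (forall i j : 'I_t, (i < j)%N -> ~~ [disjoint A j & B i]) ->
  (t <= 'C(a + b, a))%N.
Proof.
move=> cA cB dAB mAB.
pose e (x : T) : rat := (enum_rank x).+1%:R.
have e_inj : injective e.
  by move=> x z /eqP; rewrite eqr_nat eqSS => /eqP/val_inj/enum_rank_inj.
pose P j : {poly rat} := \prod_(z in A j) ('X - (e z)%:P).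
(* B i is padded to size b with the point 0, which is no e x *)
pose y i (k : 'I_b) : rat := nth 0 (map e (enum (B i))) k.
have P_eval j x : ((P j).[x] == 0) = (x \in map e (enum (A j))).
  rewrite /P horner_prod; apply/prodf_eq0/mapP.
    by case=> z zA; rewrite !hornerE subr_eq0 => /eqP ->; exists z; rewrite ?mem_enum.
  by case=> z; rewrite mem_enum => zA ->; exists z; rewrite // !hornerE subrr.
apply: (@triangular_evaluations _ a b t P y) => [j|i|i j ij].
- by rewrite /P -big_enum size_prod_XsubC -cardE ltnS.
- apply/prodf_neq0 => k _; rewrite P_eval; apply/mapP => -[z].
  rewrite mem_enum => zA; rewrite /y.
  have [kB|kB] := ltnP k (size (enum (B i))); last first.
    rewrite nth_default ?size_map // => /eqP; rewrite eq_sym pnatr_eq0.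
    by [].
  rewrite (nth_map z) // => /e_inj zE.
  have := disjointFr (dAB i) zA; rewrite -zE -mem_enum.
  by rewrite mem_nth.
- apply/eqP; have /pred0Pn[z /andP[/= zA zB]] := mAB _ _ ij.
  have zlt : (index z (enum (B i)) < b)%N.
    by rewrite (leq_trans _ (cB i)) // cardE index_mem mem_enum.
  apply/prodf_eq0; exists (Ordinal zlt) => //.
  rewrite P_eval /y (nth_map z) ?index_mem ?mem_enum //= nth_index ?mem_enum //.
  by rewrite map_f ?mem_enum.
Qed.

(** * Umbrella orderings and clique coverings *)

(** These are the vertex orderings known from proper interval graphs. The condition retains all that
    is used of the intervals, and it is invariant under reflection of the line, so that arguments
    about the right also serve for the left. *)
Definition umbrella (R : realDomainType) (G : sgraph) (p : G -> R) : Prop :=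
  injective p /\
  forall x y z, p x < p y < p z -> adj x z -> adj x y && adj y z.

Lemma umbrellaN (R : realDomainType) (G : sgraph) (p : G -> R) :
  umbrella p -> umbrella (fun x => - p x).
Proof.
move=> [p_inj up]; split=> [x y /oppr_inj /p_inj //|x y z].
rewrite !ltrN2 andbC => /up h; rewrite adj_sym => /h.
by rewrite andbC !(adj_sym y).
Qed.

Lemma umbrella_linear (R : realType) (G : sgraph) :
  linear_interval_graph G R -> exists p : G -> R, umbrella p.
Proof.
move=> [p [I [p_inj _ adjE]]]; exists p; split=> // x y z /andP[xy yz].
have neq u v : p u < p v -> u != v by apply: contraTneq => ->; rewrite ltxx.
rewrite (adjE x z) ?(adjE x y) ?(adjE y z) ?neq ?(lt_trans xy yz) // => /hasP[i iI].
rewrite !in_itv /= => /andP[/andP[ix xi] /andP[iz zi]].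
by apply/andP; split; apply/hasP; exists i; rewrite // !in_itv /= ?ix ?zi ?xi ?iz /=;
  apply/andP; split; lra.
Qed.

Lemma cliqueP (G : sgraph) (K : {set G}) :
  reflect {in K &, forall x y, x != y -> adj x y} (clique K).
Proof.
apply: (iffP forall_inP) => [h x y /h /forall_inP hx /hx /implyP //|h x xK].
by apply/forall_inP => y yK; apply/implyP; apply: h.
Qed.

Lemma has_k_clique_coveringP (G : sgraph) (k : nat) :
  reflect (exists C : {set {set G}},
    [/\ forall K, K \in C -> clique K,
        forall x y, adj x y -> exists2 K, K \in C & (x \in K) && (y \in K) &
        forall x : G, (#|[set K in C | x \in K]| <= k)%N])
   (has_k_clique_covering G k).
Proof.
apply: (iffP existsP) => -[C].
  case/andP => /andP[/forall_inP Ccl /forallP cov] /forallP deg; exists C.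
  split=> // x y xy; apply/exists_inP.
  by move/forallP: (cov x) => /(_ y)/implyP; apply.
case=> Ccl cov deg; exists C; apply/andP; split; last exact/forallP.
apply/andP; split; first exact/forall_inP.
apply/forallP => x; apply/forallP => y; apply/implyP => /cov ?.
exact/exists_inP.
Qed.

(** * Lower bound: cliques of twin-free graphs *)

(** List [X] from left to right. No clique contains a vertex together with its separator, whereas
    the edge from a later vertex to the separator of an earlier one lies in a clique of the
    covering: this is the skew Bollobas situation on the set of cliques. *)
Lemma card_separated (R : realDomainType) (G : sgraph) (p : G -> R) (k : nat)
    (X : {set G}) :
  injective p -> has_k_clique_covering G k ->
  (forall v, v \in X -> exists w, [/\ w != v, ~~ adj v w &
     forall u, u \in X -> p v < p u -> adj u w]) ->
  (#|X| <= 'C(k + k, k))%N.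
Proof.
move=> p_inj /has_k_clique_coveringP[C [Ccl Ccov Cdeg]] sepX.
have /fin_all_exists[w wP] : forall v, exists w, v \in X -> [/\ w != v, ~~ adj v w &
     forall u, u \in X -> p v < p u -> adj u w].
  by move=> v; have [/sepX[w wP]|_] := boolP (v \in X); [exists w | exists v].
case: (set_0Vmem X) => [->|[x0 _]]; first by rewrite cards0.
pose s := sort (relpre p <=%R) (enum X).
have mem_s x : (x \in s) = (x \in X) by rewrite mem_sort mem_enum.
have s_size : size s = #|X| by rewrite size_sort -cardE.
have s_lt i j : (i < j)%N -> (j < #|X|)%N -> p (nth x0 s i) < p (nth x0 s j).
  move=> ij jX; have iX := ltn_trans ij jX.
  rewrite lt_neqAle (inj_eq p_inj) nth_uniq ?s_size ?sort_uniq ?enum_uniq //.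
  rewrite (ltn_eqF ij) /=.
  apply: (sorted_ltn_nth (leT := relpre p <=%R)) => //; rewrite ?inE ?s_size //.
    by move=> u v z; apply: le_trans.
  by apply: sort_sorted => u v; apply: le_total.
have s_in i : (i < #|X|)%N -> nth x0 s i \in X.
  by move=> iX; rewrite -mem_s mem_nth ?s_size.
apply: (@skew_bollobas _ k k #|X|
  (fun j => [set K in C | nth x0 s j \in K])
  (fun i => [set K in C | w (nth x0 s i) \in K])) => // [i|i j ij].
  have [wv /negP vw _] := wP _ (s_in i (ltn_ord i)).
  rewrite -setI_eq0; apply/eqP/setP => K; rewrite !inE.
  apply/negP => /andP[/andP[/Ccl/cliqueP Kcl vK] /andP[_ wK]].
  by apply: vw; apply: Kcl => //; rewrite eq_sym.
have [_ _ adjw] := wP _ (s_in i (ltn_ord i)).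
have /Ccov[K KC /andP[uK wK]] := adjw _ (s_in j (ltn_ord j)) (s_lt _ _ ij (ltn_ord j)).
by apply/pred0Pn; exists K; rewrite /= !inE KC uK wK.
Qed.

(** Since [w] misses [v] but sees [v'], the umbrella condition forces [w] to the right of all of
    [K]. Then [z] equals [v'] or lies between [v'] and [w], and so sees [w]. *)
Lemma separated_by_next (R : realDomainType) (G : sgraph) (p : G -> R)
    (K : {set G}) (v v' w : G) :
  umbrella p -> clique K -> v \in K -> v' \in K -> p v < p v' ->
  (forall z, z \in K -> p v < p z -> p v' <= p z) ->
  w != v -> ~~ adj v w -> adj v' w ->
  forall z, z \in K -> p v < p z -> adj z w.
Proof.
move=> [p_inj up] /cliqueP Kcl vK v'K vv' next wv nvw v'w z zK vz.
have adjv u : u \in K -> p v < p u -> adj v u.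
  by move=> uK vu; apply: Kcl => //; apply: contraTneq vu => ->; rewrite ltxx.
have vw : p v < p w.
  rewrite ltNge le_eqVlt (inj_eq p_inj) (negbTE wv) /=; apply/negP => wv'.
  have := up w v v'; rewrite wv' vv' adj_sym v'w => /(_ isT isT).
  by rewrite adj_sym (negbTE nvw).
have zw : p z < p w.
  rewrite ltNge le_eqVlt (inj_eq p_inj); apply/negP => /orP[/eqP wz|wz].
    by rewrite wz adjv in nvw.
  by have := up v w z; rewrite vw wz adjv // (negbTE nvw) => /(_ isT isT).
have := next z zK vz; rewrite le_eqVlt (inj_eq p_inj) => /orP[/eqP <- //|v'z].
by have := up v' z w; rewrite v'z zw => /(_ isT v'w) /andP[].
Qed.

Lemma twin_free_clique_card (R : realDomainType) (G : sgraph) (p : G -> R)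
    (k : nat) (K : {set G}) :
  umbrella p -> twin_free G -> has_k_clique_covering G k -> clique K ->
  (#|K| <= 1 + 2 * 'C(k + k, k))%N.
Proof.
move=> up tf hk Kcl; have [p_inj _] := up.
pose sep (lt : rel G) v w :=
  [&& w != v, ~~ adj v w & [forall u in K, lt v u ==> adj u w]].
pose X lt := [set v in K | [exists w, sep lt v w]].
pose Xr := X (fun v u => p v < p u); pose Xl := X (fun v u => p u < p v).
have cXr : (#|Xr| <= 'C(k + k, k))%N.
  apply: (card_separated p_inj hk) => v; rewrite inE => /andP[vK /existsP[w]].
  case/and3P=> wv vw /forall_inP h; exists w; split=> // u.
  by rewrite inE => /andP[/h /implyP].
have cXl : (#|Xl| <= 'C(k + k, k))%N.
  apply: (@card_separated _ _ (fun x => - p x)) => // [x y /oppr_inj/p_inj //|v].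
  rewrite inE => /andP[vK /existsP[w]].
  case/and3P=> wv vw /forall_inP h; exists w; split=> // u.
  by rewrite inE ltrN2 => /andP[/h /implyP].
case: (set_0Vmem K) => [->|[v0 v0K]]; first by rewrite cards0.
pose vm := [arg max_(u > v0 in K) p u]%O.
have vm_max u : u \in K -> u != vm -> p u < p vm.
  rewrite /vm; case: arg_maxP => // m mK mmax uK um.
  by rewrite lt_neqAle (inj_eq p_inj) um /=; apply: mmax.
have vmK : vm \in K by rewrite /vm; case: arg_maxP.
have /fin_all_exists[nx nxP] : forall v, exists v', v \in K :\ vm ->
    [/\ v' \in K, p v < p v' & forall z, z \in K -> p v < p z -> p v' <= p z].
  move=> v; have [|_] := boolP (v \in K :\ vm); last by exists v.
  rewrite !inE => /andP[vvm vK].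
  have Pvm : (vm \in K) && (p v < p vm) by rewrite vmK vm_max.
  case: (@arg_minP _ _ _ vm [pred u | (u \in K) && (p v < p u)] p Pvm).
  move=> v' /= /andP[v'K vv'] v'min; exists v' => _; split=> // z zK vz.
  by apply: v'min; rewrite /= zK vz.
have nx_inj : {in K :\ vm &, injective nx}.
  move=> u v uK vK e; have [_ uu' umin] := nxP _ uK.
  have [_ vv' vmin] := nxP _ vK.
  apply/p_inj/eqP; apply: contraT; rewrite neq_lt => /orP[] lt.
    have vK' : v \in K by case/setD1P: vK.
    by have := umin _ vK' lt; rewrite e leNgt vv'.
  have uK' : u \in K by case/setD1P: uK.
  by have := vmin _ uK' lt; rewrite -e leNgt uu'.
(* A vertex with no separator on its right passes the task to its successor, which must then have
   one on its left; [nx] thus embeds [D] into [Xl]. *)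
pose D := (K :\ vm) :\: Xr.
have nxD v : v \in D -> nx v \in Xl.
  rewrite !inE => /andP[nXr /andP[vvm vK]].
  have vKm : v \in K :\ vm by rewrite !inE vvm.
  have [v'K vv' next] := nxP _ vKm; set v' := nx v in v'K vv' next *.
  rewrite vK /= in nXr; rewrite v'K /=; apply: contraT => nXl.
  have v_neq : v != v' by apply: contraTneq vv' => ->; rewrite ltxx.
  have avv' : adj v v' by move/cliqueP: Kcl; apply.
  case/negP: (tf v v'); rewrite /twins avv' /=; apply/eqP/setP => w.
  rewrite !inE.
  case: (eqVneq w v) => [->|wv]; first by rewrite adj_irr andbF.
  case: (eqVneq w v') => [->|wv']; rewrite /= ?adj_irr //.
  (* A vertex that sees [v] but not [v'] separates [v'] on the left, by reflection; one that sees
     [v'] but not [v] separates [v] on the right. *)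
  apply/idP/idP => aw; apply: contraT => naw.
    case/existsP: nXl; exists w; rewrite /sep wv' naw /=.
    apply/forall_inP => z zK; apply/implyP => zv'.
    apply: (separated_by_next (umbrellaN up) Kcl v'K vK _ _ wv' naw aw) => //.
    - by rewrite ltrN2.
    - move=> u uK; rewrite ltrN2 lerN2 => uv'; rewrite leNgt.
      by apply/negP => /(next _ uK); rewrite leNgt uv'.
    - by rewrite ltrN2.
  case/existsP: nXr; exists w; rewrite /sep wv naw /=.
  apply/forall_inP => z zK; apply/implyP => vz.
  exact: (separated_by_next up Kcl vK v'K vv' next wv naw aw).
have cD : (#|D| <= 'C(k + k, k))%N.
  rewrite -(card_in_imset (f := nx)) => [|u v /setDP[uK _] /setDP[vK _]]; last exact: nx_inj.
  apply: leq_trans (subset_leq_card _) cXl.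
  by apply/subsetP => _ /imsetP[v vD ->]; apply: nxD.
rewrite (cardsD1 vm) vmK leq_add2l -(cardsID Xr).
by rewrite mul2n -addnn leq_add // (leq_trans _ cXr) // subset_leq_card // subsetIr.
Qed.

Lemma right_neighbours_clique (R : realDomainType) (G : sgraph) (p : G -> R)
    (x : G) :
  umbrella p -> clique (x |: [set y in neighbours x | p x < p y]).
Proof.
move=> [p_inj up]; apply/cliqueP => u v; rewrite !inE.
have key y z : adj x z -> p x < p y -> p y < p z -> adj y z.
  by move=> xz xy yz; have := up x y z; rewrite xy yz => /(_ isT xz)/andP[].
move=> /orP[/eqP->|/andP[xu pu]] /orP[/eqP->|/andP[xv pv]] //.
- by rewrite eqxx.
- by rewrite adj_sym.
rewrite -(inj_eq p_inj) neq_lt => /orP[uv|vu]; first exact: key uv.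
by rewrite adj_sym; apply: key vu.
Qed.

Lemma twin_free_max_degree (R : realDomainType) (G : sgraph) (p : G -> R)
    (k : nat) :
  umbrella p -> twin_free G -> has_k_clique_covering G k ->
  (max_degree G <= 4 * 'C(k + k, k))%N.
Proof.
move=> up tf hk; apply/bigmax_leqP => x _.
have half q : umbrella q ->
    (#|[set y in neighbours x | q x < q y :> R]| <= 2 * 'C(k + k, k))%N.
  move=> uq; have := twin_free_clique_card uq tf hk (right_neighbours_clique x uq).
  (* The vertex [x] itself accounts for the 1 in the bound on cliques. *)
  by rewrite cardsU1 !inE ltxx andbF leq_add2l.
rewrite -(cardsID [set y | p x < p y]) (_ : 4 = 2 + 2)%N // mulnDl leq_add //.
  by apply: leq_trans (half _ up); rewrite subset_leq_card //; apply/subsetP => y; rewrite !inE.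
apply: leq_trans (half _ (umbrellaN up)); rewrite subset_leq_card //.
apply/subsetP => y; rewrite !inE => /andP[pxy xy]; rewrite xy ltrN2 /=.
rewrite lt_neqAle leNgt pxy andbT (inj_eq up.1).
by apply: contraTneq xy => ->; rewrite adj_irr.
Qed.

(** * Upper bound: the partition into blocks *)

Section Blocks.
Variables (R : realDomainType) (G : sgraph) (p : G -> R).
Hypothesis up : umbrella p.

Definition independent (S : {set G}) : bool :=
  [forall u in S, forall v in S, ~~ adj u v].

(* Maximal independent sets being greedy here, block x is also the index of the
   block of x in the greedy partition of the line into cliques. *)
Definition block (x : G) : nat :=
  \max_(S : {set G} | independent S && [forall u in S, p u <= p x]) #|S|.

Lemma independentP (S : {set G}) :
  reflect {in S &, forall u v, ~~ adj u v} (independent S).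
Proof.
apply: (iffP forall_inP) => [h u v /h /forall_inP hu /hu //|h u uS].
by apply/forall_inP => v vS; apply: h.
Qed.

Lemma leq_block (S : {set G}) (x : G) :
  {in S &, forall u v, ~~ adj u v} -> {in S, forall u, p u <= p x} ->
  (#|S| <= block x)%N.
Proof.
move=> Si Sx.
apply: (@leq_bigmax_cond _ _ (fun S : {set G} => #|S|)).
by apply/andP; split; [apply/independentP | apply/forall_inP].
Qed.

Lemma block_witness (x : G) : exists S : {set G},
  [/\ {in S &, forall u v, ~~ adj u v}, {in S, forall u, p u <= p x} &
      #|S| = block x].
Proof.
pose ok := [pred S : {set G} | independent S && [forall u in S, p u <= p x]].
have : (0 < #|ok|)%N.
  apply/card_gt0P; exists set0; rewrite inE; apply/andP; split.
    by apply/independentP => u v; rewrite inE.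
  by apply/forall_inP => u; rewrite inE.
case/(eq_bigmax_cond (fun S : {set G} => #|S|)) => S.
by rewrite inE => /andP[/independentP Si /forall_inP Sx] eS; exists S.
Qed.

Lemma block_gt0 (x : G) : (0 < block x)%N.
Proof.
rewrite -(cards1 x); apply: leq_block => [u v|u]; rewrite !inE => /eqP->.
  by move=> /eqP->; rewrite adj_irr.
exact: lexx.
Qed.

Lemma block_homo (x y : G) : p x <= p y -> (block x <= block y)%N.
Proof.
move=> xy; have [S [Si Sx <-]] := block_witness x.
by apply: leq_block => // u /Sx ux; apply: le_trans xy.
Qed.

(** An optimal set for [x] can be enlarged by [y]: a neighbour of [y] at or before [x] would make
    [x] adjacent to [y]. *)
Lemma block_lt (x y : G) : p x < p y -> ~~ adj x y -> (block x < block y)%N.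
Proof.
move=> xy nxy; have [S [Si Sx <-]] := block_witness x.
have yS : y \notin S by apply/negP => /Sx; rewrite leNgt xy.
have -> : #|S|.+1 = #|y |: S| by rewrite cardsU1 yS.
have nuy u : u \in S -> ~~ adj u y.
  move=> /Sx; rewrite le_eqVlt (inj_eq up.1) => /orP[/eqP->//|ux].
  by apply: contra nxy => uy; have := up.2 u x y; rewrite ux xy => /(_ isT uy)/andP[].
apply: leq_block => [u v|u]; rewrite !inE => /orP[/eqP->|uS].
- by case/orP=> [/eqP->|/nuy]; rewrite ?adj_irr // adj_sym.
- by case/orP=> [/eqP->|vS]; [exact: nuy | exact: Si].
- exact: lexx.
- by rewrite (le_trans (Sx _ uS)) ?ltW.
Qed.

(** The vertices after [x] and up to [y] form a clique, so an optimal set for [y] has at most one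
    member there; the others count for [x]. *)
Lemma block_adj (x y : G) : p x < p y -> adj x y -> (block y <= (block x).+1)%N.
Proof.
move=> xy axy; have [S [Si Sy <-]] := block_witness y.
rewrite -(cardsID [set u | p u <= p x]) -addn1 leq_add //.
  by apply: leq_block => [u v /setIP[uS _] /setIP[vS _]|u /setIP[_]];
    rewrite ?inE //; apply: Si.
apply/card_le1_eqP.
have key u v : u \in S -> v \in S -> p x < p u -> ~~ (p u < p v).
  move=> uS vS xu; apply/negP => uv.
  have xv : adj x v.
    have := Sy v vS; rewrite le_eqVlt (inj_eq up.1) => /orP[/eqP->//|vy].
    by have := up.2 x v y; rewrite (lt_trans xu uv) vy => /(_ isT axy)/andP[].
  have := up.2 x u v; rewrite xu uv => /(_ isT xv)/andP[_].
  by apply/negP; apply: Si.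
move=> v u; rewrite !inE -!ltNge => /andP[xv vS] /andP[xu uS].
apply/up.1/eqP; apply: contraT; rewrite neq_lt => /orP[] h.
  by have := key u v uS vS xu; rewrite h.
by have := key v u vS uS xv; rewrite h.
Qed.

Lemma same_block_adj (x y : G) : x != y -> block x = block y -> adj x y.
Proof.
rewrite -(inj_eq up.1) neq_lt => /orP[] lt e; apply: contraT => na.
  by have := block_lt lt na; rewrite e ltnn.
by have := block_lt lt; rewrite adj_sym e ltnn => /(_ na).
Qed.

Definition left_rank (x : G) : nat :=
  #|[set z | (block z == block x) && (p z < p x)]|.

Definition nonadj_rank (y : G) : nat :=
  #|[set z | ((block z).+1 == block y) && ~~ adj z y]|.

(** The vertices of the block of [x] that miss [y] form an initial segment of this block, and [x] is
    outside it iff the segment is no longer than [left_rank x]. The successor yields the strict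
    comparison of [half_graph_labels]. *)
Lemma next_block_adj (x y : G) : block y = (block x).+1 ->
  adj x y = (nonadj_rank y < (left_rank x).+1)%N.
Proof.
move=> yx.
have lt z : block z = block x -> p z < p y.
  move=> zx; rewrite ltNge; apply/negP => /block_homo.
  by rewrite zx yx ltnn.
apply/idP/idP => [xy|].
  rewrite ltnS subset_leq_card //; apply/subsetP => z.
  rewrite !inE yx eqSS => /andP[/eqP zx nzy]; rewrite zx eqxx /= ltNge.
  rewrite le_eqVlt (inj_eq up.1); apply/negP => /orP[/eqP e|xz].
    by rewrite -e xy in nzy.
  have := up.2 x z y; rewrite xz lt // => /(_ isT xy)/andP[_].
  exact/negP.
apply: contraTT => nxy; rewrite -leqNgt.
have -> : (left_rank x).+1 = #|x |: [set z | (block z == block x) && (p z < p x)]|.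
  by rewrite cardsU1 !inE ltxx andbF.
apply: subset_leq_card; apply/subsetP => z.
rewrite !inE yx eqSS => /orP[/eqP->|/andP[/eqP zx pzx]]; first by rewrite eqxx.
rewrite zx eqxx /=; apply: contra nxy => zy.
by have := up.2 z x y; rewrite pzx lt // => /(_ isT zy)/andP[].
Qed.

Lemma left_rank_max_degree (x : G) : (left_rank x <= max_degree G)%N.
Proof.
apply: (leq_trans _ (leq_bigmax x)); apply: subset_leq_card.
apply/subsetP => z; rewrite !inE => /andP[/eqP zx pzx].
by apply: same_block_adj => //; apply: contraTneq pzx => ->; rewrite ltxx.
Qed.

(** The set counted lies in one block, hence is a clique. *)
Lemma nonadj_rank_max_degree (y : G) : (nonadj_rank y <= (max_degree G).+1)%N.
Proof.
rewrite /nonadj_rank; set S := [set z | _].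
case: (set_0Vmem S) => [->|[x xS]]; first by rewrite cards0.
apply: (@leq_trans #|x |: neighbours x|).
  apply: subset_leq_card; apply/subsetP => z; move: xS; rewrite !inE.
  move=> /andP[/eqP xy _] /andP[/eqP zy _]; case: eqVneq => //= zx.
  by apply: same_block_adj; [rewrite eq_sym | apply: succn_inj; rewrite xy].
by rewrite cardsU1 -addn1 addnC leq_add ?leq_b1 // leq_bigmax.
Qed.

Lemma block_clique_covering (a b : nat) :
  ((max_degree G).+1 < 'C(a + b, a))%N -> has_k_clique_covering G (a + b).+1.
Proof.
move=> bin_gt; have [A [B [sA sB _ AB]]] := half_graph_labels a b.
pose blockset x := [set z | block z == block x].
(* The biclique of label [s] between blocks [m] and [m.+1]; it is a clique of [G] because each block
   is one. *)
pose join m s := [set z |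
  (block z == m) && (s \in A (left_rank z).+1) ||
  (block z == m.+1) && (s \in B (nonadj_rank z))].
(* The family consists of all cliques in these lists, and those containing [v] all occur in [L v],
   of length at most 1 + a + b. *)
pose L v := blockset v :: map (join (block v)) (A (left_rank v).+1) ++
  map (join (block v).-1) (B (nonadj_rank v)).
have predK v : (block v).-1.+1 = block v by rewrite prednK ?block_gt0.
have join_L v m s : v \in join m s -> join m s \in L v.
  rewrite inE => /orP[] /andP[/eqP vm sv]; rewrite in_cons mem_cat.
    by rewrite -vm map_f ?orbT.
  by rewrite -[m]/(m.+1.-1) -vm map_f ?orbT.
have AB_adj x y s : block y = (block x).+1 -> s \in A (left_rank x).+1 ->
    s \in B (nonadj_rank y) -> adj x y.
  move=> yx sx sy; rewrite next_block_adj // -AB.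
  - by apply/hasP; exists s.
  - exact: leq_ltn_trans (nonadj_rank_max_degree y) bin_gt.
  - by rewrite (leq_ltn_trans _ bin_gt) ?ltnS ?left_rank_max_degree.
have LP v K : K \in L v -> K = blockset v \/ exists m s, K = join m s.
  rewrite in_cons mem_cat => /or3P[/eqP ->|/mapP[s _ ->]|/mapP[s _ ->]]; first by left.
    by right; exists (block v), s.
  by right; exists (block v).-1, s.
apply/has_k_clique_coveringP; exists [set K | [exists v, K \in L v]]; split.
- move=> K; rewrite inE => /existsP[v /LP[->|[m [s ->]]]]; apply/cliqueP => x y.
    by rewrite !inE => /eqP xv /eqP yv xy; apply: same_block_adj; rewrite // xv.
  rewrite !inE => /orP[] /andP[/eqP xm sx] /orP[] /andP[/eqP ym sy] xy.
  + by apply: same_block_adj; rewrite // xm.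
  + by apply: (AB_adj x y s); rewrite // xm.
  + by rewrite adj_sym; apply: (AB_adj y x s); rewrite // ym.
  + by apply: same_block_adj; rewrite // xm.
- have cover x y : p x < p y -> adj x y ->
      exists2 K, K \in [set K | [exists v, K \in L v]] & (x \in K) && (y \in K).
    move=> lt xy; have := block_homo (ltW lt); rewrite leq_eqVlt.
    case/orP=> [/eqP e|blt].
      exists (blockset x); last by rewrite !inE e eqxx.
      by rewrite inE; apply/existsP; exists x; rewrite mem_head.
    have yx : block y = (block x).+1.
      by apply/eqP; rewrite eqn_leq blt block_adj.
    move: xy; rewrite next_block_adj // -AB.
    + case/hasP=> s sy /= sx; exists (join (block x) s).
        rewrite inE; apply/existsP; exists x; apply: join_L.
        by rewrite inE eqxx sx.
      by rewrite !inE yx !eqxx sx sy orbT.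
    + exact: leq_ltn_trans (nonadj_rank_max_degree y) bin_gt.
    + by rewrite (leq_ltn_trans _ bin_gt) ?ltnS ?left_rank_max_degree.
  move=> x y xy; have : x != y by apply: contraTneq xy => ->; rewrite adj_irr.
  rewrite -(inj_eq up.1) neq_lt => /orP[] lt; first exact: cover.
  have [|K KC] := cover y x lt; first by rewrite adj_sym.
  by rewrite andbC; exists K.
- move=> v; apply: (@leq_trans (size (L v))).
    apply: leq_trans (card_size (L v)); apply: subset_leq_card.
    apply/subsetP => K /setIdP[]; rewrite inE => /existsP[u /LP[->|[m [s ->]]]].
      rewrite inE => /eqP vu.
      by have -> : blockset u = blockset v; [rewrite /blockset vu | rewrite mem_head].
    exact: join_L.
  by rewrite /= size_cat !size_map ltnS leq_add.
Qed.

End Blocks.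

(** * Logarithms and the two final estimates *)

Lemma has_lcc_covering (G : sgraph) : has_k_clique_covering G (lcc G).
Proof. by rewrite /lcc; case: ex_minnP. Qed.

Lemma lcc_le (G : sgraph) (k : nat) : has_k_clique_covering G k -> (lcc G <= k)%N.
Proof. by rewrite /lcc; case: ex_minnP => m _; apply. Qed.

Section Log2.
Variable R : realType.
Implicit Types x y : R.

Let ln2_gt0 : 0 < ln 2 :> R.
Proof. by apply: ln_gt0; lra. Qed.

Lemma log2M x y : 0 < x -> 0 < y -> log2 (x * y) = log2 x + log2 y.
Proof. by move=> x0 y0; rewrite /log2 lnM ?posrE // mulrDl. Qed.

Lemma log2X x n : 0 < x -> log2 (x ^+ n) = n%:R * log2 x.
Proof. by move=> x0; rewrite /log2 lnXn // [RHS]mulr_natl mulrnAl. Qed.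

Lemma log2_2 : log2 2 = 1 :> R.
Proof. by rewrite /log2 divff // gt_eqF. Qed.

Lemma log2_exp2 n : log2 (2 ^+ n) = n%:R :> R.
Proof. by rewrite log2X // log2_2 mulr1. Qed.

Lemma le_log2 x y : 0 < x -> x <= y -> log2 x <= log2 y.
Proof.
move=> x0 xy; rewrite /log2 ler_pM2r ?invr_gt0 // ler_ln ?posrE //.
exact: lt_le_trans xy.
Qed.

End Log2.

Lemma lcc_upper (R : realType) (G : sgraph) (p : G -> R) :
  umbrella p -> (2 <= max_degree G)%N ->
  (lcc G)%:R <= log2 (max_degree G)%:R
    + 1 / 2 * log2 (log2 (max_degree G)%:R) + 11 / 2 :> R.
Proof.
move=> up; set d := max_degree G => d_ge2.
have ex : exists h, (d.+1 < 'C(h + h, h))%N.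
  exists d.+2; apply: leq_trans (_ : 2 ^ d.+2 <= _)%N.
    by rewrite ltnW // ltn_expl.
  by rewrite addnn expn2_central_bin.
case: (ex_minnP ex) => h hd hmin.
have lcc_h : (lcc G <= (h + h).+1)%N by exact/lcc_le/(block_clique_covering up).
case: h hd hmin lcc_h => [|[|m]] hd hmin lcc_h.
- by move: hd; rewrite bin0; lia.
- by move: hd; rewrite bin1; lia.
(* Minimality of h = m + 2 bounds the preceding central binomial coefficient from above. *)
have bd : ('C(m.+1.*2, m.+1) <= d.+1)%N.
  by rewrite -addnn leqNgt; apply/negP => /hmin; rewrite ltnn.
have {}bd : ('C(m.+1.*2, m.+1) <= 2 * d)%N by lia.
set L : R := log2 d%:R.
have d_gt0 : 0 < d%:R :> R by rewrite ltr0n; lia.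
have L_ge1 : 1 <= L by rewrite -(@log2_2 R) le_log2 // ler_nat.
(* A crude bound suffices here, as m + 1 will enter only through its logarithm: 2^(m + 1) <= 2d
   gives m + 1 <= 1 + L. *)
have mL : m.+1%:R <= 2 * L.
  have : log2 (2 ^+ m.+1) <= log2 (2 * d%:R) :> R.
    rewrite le_log2 ?exprn_gt0 // -natrX -natrM ler_nat.
    exact: leq_trans (expn2_central_bin _) bd.
  rewrite log2_exp2 log2M // log2_2 -/L; lra.
have key : (16 ^ m.+1)%:R <= 2 ^+ 5 * (d%:R ^+ 2 * L) :> R.
  apply: (@le_trans _ _ (16 * d ^ 2 * m.+1)%:R).
    rewrite ler_nat (leq_trans (central_bin_lower (ltn0Sn m))) //.
    have : ('C(m.+1.*2, m.+1) ^ 2 <= (2 * d) ^ 2)%N by rewrite leq_exp2r.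
    by rewrite expnMn; nia.
  rewrite natrM natrM natrX.
  have -> : 2 ^+ 5 * (d%:R ^+ 2 * L) = 16%:R * d%:R ^+ 2 * (2 * L) by ring.
  by rewrite ler_wpM2l // mulr_ge0 ?exprn_ge0 ?ltW.
have L_gt0 : 0 < L by lra.
have : log2 (16 ^ m.+1)%:R <= log2 (2 ^+ 5 * (d%:R ^+ 2 * L)) :> R.
  by rewrite le_log2 // ltr0n expn_gt0.
have d2_gt0 : 0 < d%:R ^+ 2 :> R by rewrite exprn_gt0.
have e5_gt0 : 0 < 2 ^+ 5 :> R by rewrite exprn_gt0.
rewrite (log2M e5_gt0 (mulr_gt0 d2_gt0 L_gt0)) (log2M d2_gt0 L_gt0).
rewrite log2_exp2 log2X // -/L.
rewrite (_ : 16 = 2 ^ 4)%N // -expnM natrX log2_exp2.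
(* From 4(m + 1) <= 5 + 2L + log L, the bound 2(m + 1) + 3 is at most L + (log L)/2 + 5/2 + 3. *)
have : (lcc G)%:R <= (m.+2 + m.+2).+1%:R :> R by rewrite ler_nat.
lra.
Qed.

Lemma lcc_lower (R : realType) (G : sgraph) (p : G -> R) :
  umbrella p -> (2 <= max_degree G)%N -> twin_free G ->
  1 / 2 * log2 (max_degree G)%:R
    + 1 / 4 * log2 (log2 (max_degree G)%:R) - 5 / 4 <= (lcc G)%:R :> R.
Proof.
move=> up; set d := max_degree G => d_ge2 tf; set k := lcc G.
have := twin_free_max_degree up tf (has_lcc_covering G).
rewrite addnn -/d -/k => d_le.
set L : R := log2 d%:R.
have d_gt0 : 0 < d%:R :> R by rewrite ltr0n; lia.
have L_ge1 : 1 <= L by rewrite -(@log2_2 R) le_log2 // ler_nat.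
have key : (d ^ 2 * k.*2.+1 <= 2 ^ (4 + 4 * k))%N.
  rewrite expnD expnM (_ : 2 ^ 4 = 16)%N //.
  have := central_bin_upper k.
  have : (d ^ 2 <= (4 * 'C(k.*2, k)) ^ 2)%N by rewrite leq_exp2r.
  by rewrite expnMn; nia.
have keyL : 2 * L + log2 k.*2.+1%:R <= 4 + 4 * k%:R :> R.
  have : log2 (d ^ 2 * k.*2.+1)%:R <= log2 (2 ^ (4 + 4 * k))%:R :> R.
    by rewrite le_log2 ?ler_nat // ltr0n; nia.
  by rewrite natrM !natrX log2M ?exprn_gt0 // log2X // log2_exp2 natrD natrM.
have pos : 0 <= log2 k.*2.+1%:R :> R.
  by rewrite /log2 divr_ge0 ?ln_ge0 ?ler1n.
(* Dropping the logarithm from [keyL] gives L <= 2 + 2k <= 2(2k + 1). Feeding log L - 1 <= log(2k +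
   1) back into [keyL] yields the constant (4 + 1)/4. *)
have : log2 L <= log2 (2 * k.*2.+1%:R).
  rewrite le_log2 //; first lra.
  have -> : k.*2.+1%:R = 2 * k%:R + 1 :> R by rewrite -natr1 -mul2n natrM.
  have : 0 <= k%:R :> R by [].
  lra.
rewrite log2M // log2_2; lra.
Qed.

Theorem theorem4 (R : realType) :
  exists C1 C2 : R, forall G : sgraph,
    linear_interval_graph G R -> (2 <= max_degree G)%N ->
    let D : R := (max_degree G)%:R in
    ((lcc G)%:R <= log2 D + 1 / 2 * log2 (log2 D) + C1) /\
    (twin_free G ->
       1 / 2 * log2 D + 1 / 4 * log2 (log2 D) - C2 <= (lcc G)%:R).
Proof.
exists (11 / 2), (5 / 4) => G /umbrella_linear[p up] d_ge2 D.
by split=> [|tf]; [apply: lcc_upper up _ | apply: lcc_lower up _ tf].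
Qed.
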